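(* Let $l_R>0$ and $l_O>0$ be real numbers and let $$X=\{p\in\mathbb{R}^2 : \|p\|>l_O+l_R\},$$ where $\|\cdot\|$ is the Euclidean norm and $X$ carries the subspace topology from $\mathbb{R}^2$. Then the topological complexity of $X$ is $$\mathrm{TC}(X)=2.$$
   Context: For a topological space $X$, $\mathrm{P}X$ denotes the space of all continuous paths $\gamma:[0,1]\to X$, equipped with the compact-open topology. The topological complexity $\mathrm{TC}(X)$ is the least positive integer $m$ such that $X\times X$ can be covered by $m$ open subsets, $X\times X=U_1\cup\cdots\cup U_m$, where for each $i=1,\dots,m$ there exists a continuous map $s_i:U_i\to \mathrm{P}X$ with $s_i(x_1,x_2)(0)=x_1$ and $s_i(x_1,x_2)(1)=x_2$ for all $(x_1,x_2)\in U_i$. If no such $m$ exists, $\mathrm{TC}(X)=\infty$. (Note that this is the non-reduced convention.) The space $X$ in the claim is the obstacle-free state space of a mobile robot of radius $l_R$ moving in the plane with an obstacle of radius $l_O$ centred at the origin. *)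

(* Defs.v *)
From HB Require Import structures.
From mathcomp Require Import all_boot all_order all_algebra.
From mathcomp Require Import all_classical all_reals all_analysis.

Set Implicit Arguments.
Unset Strict Implicit.
Unset Printing Implicit Defensive.

Import Order.TTheory GRing.Theory Num.Theory.
Import numFieldNormedType.Exports.

Local Open Scope classical_set_scope.
Local Open Scope ring_scope.

                                                                           
                                                                             
                       
Definition unit_interval (R : realType) : topologicalType :=
  set_type [set t : R | 0 <= t <= 1].

Lemma unit_interval_0_subproof (R : realType) :
  (0 : R) \in [set t : R | 0 <= t <= 1].
Proof. by rewrite inE /= lexx ler01. Qed.

Lemma unit_interval_1_subproof (R : realType) :
  (1 : R) \in [set t : R | 0 <= t <= 1].
Proof. by rewrite inE /= ler01 lexx. Qed.

Definition unit_interval0 (R : realType) : unit_interval R :=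
  exist _ 0 (unit_interval_0_subproof R).

Definition unit_interval1 (R : realType) : unit_interval R :=
  exist _ 1 (unit_interval_1_subproof R).

                                                                           
                                                                         
                                                      
Definition path_space (R : realType) (X : topologicalType) : topologicalType :=
  initial_topology
    (fun g : continuousType (unit_interval R) X =>
       (g : {compact-open, unit_interval R -> X})).

Definition path_eval (R : realType) (X : topologicalType)
    (g : path_space R X) (t : unit_interval R) : X :=
  (g : continuousType (unit_interval R) X) t.

Definition has_motion_planner (R : realType) (X : topologicalType)
    (U : set (X * X)) : Prop :=
  exists s : set_type U -> path_space R X,
    continuous s /\
    forall u : set_type U,
      path_eval (s u) (unit_interval0 R) = (set_val u).1 /\
      path_eval (s u) (unit_interval1 R) = (set_val u).2.

Definition motion_cover (R : realType) (X : topologicalType) (m : nat) : Prop :=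
  exists U : 'I_m -> set (X * X),
    [/\ forall i, open (U i),
        \bigcup_i U i = setT
      & forall i, has_motion_planner R (U i)].

                                                         
Definition TC (R : realType) (X : topologicalType) : option nat :=
  if pselect (exists m, (0 < m)%N && `[< motion_cover R X m >]) is left exm
  then Some (ex_minn exm) else None.

                                                                           
                                                            
Definition euclidean_norm (R : realType) (n : nat) (p : 'rV[R]_n) : R :=
  Num.sqrt (\sum_(i < n) p ord0 i ^+ 2).

Definition free_space (R : realType) (lR lO : R) : topologicalType :=
  set_type [set p : 'rV[R]_2 | lO + lR < euclidean_norm p].

(* Main.v *)
Require Import Defs.
From HB Require Import structures.
From mathcomp Require Import all_boot all_order all_algebra.
From mathcomp Require Import all_classical all_reals all_analysis.
From mathcomp Require Import ring lra.

Import Order.TTheory GRing.Theory Num.Theory.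
Import numFieldNormedType.Exports.

Local Open Scope classical_set_scope.
Local Open Scope ring_scope.

(** The free space is the plane without a closed disc of positive radius, which
    has the homotopy type of a circle.

    Two planners suffice.  A motion from [p] to [q] is given by a direction
    field, a nowhere zero vector depending continuously on [p], [q] and the
    time, from which the position is recovered by normalising and multiplying
    by the modulus interpolated between those of [p] and [q]
    ([motion_planner_of_direction]).  Scale [p] and [q] to vectors [a] and [b]
    of the same length.  Unless [a = - b], the straight segment from [a] to [b]
    misses the origin ([segment_avoids_origin]).  Unless [a = b], the vector
    [a - b] turned by a quarter of a turn points to the middle of the
    counterclockwise arc from [a] to [b], and a large enough bump in that
    direction pushes the segment off the origin ([detour_avoids_origin]).

    One planner does not suffice.  A planner on the whole of [X * X] contracts a
    circle around the obstacle to a point, within the punctured plane.  Identify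
    the plane with the complex numbers and ask, at each time of the contraction,
    whether the nowhere zero loop has a continuous periodic square root.  The
    answer does not change in time, because two loops that are close enough have
    a quotient in the right half plane, where the square root is continuous
    ([has_periodic_sqrt_near]).  The constant loop has such a root and the
    circle has none ([circle_has_no_periodic_sqrt]).  This replaces covering
    spaces and winding numbers. *)

(** * Continuity of composite expressions *)

Lemma continuous_fun_pair {S T U : topologicalType} (f : S -> T) (g : S -> U) :
  continuous f -> continuous g -> continuous (fun x => (f x, g x)).
Proof. by move=> cf cg x; apply: cvg_pair; [exact: cf|exact: cg]. Qed.

Lemma continuous_fun_comp {S T U : topologicalType} (f : S -> T) (g : T -> U) :
  continuous g -> continuous f -> continuous (fun x => g (f x)).
Proof. by move=> cg cf x; apply: (continuous_comp (cf x)); exact: cg. Qed.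

Lemma continuous_fun_cst {S T : topologicalType} (c : T) :
  continuous (fun _ : S => c).
Proof. by move=> x; exact: cvg_cst. Qed.

Lemma continuous_fun_id {S : topologicalType} : continuous (fun x : S => x).
Proof. by move=> x; exact: cvg_id. Qed.

Lemma continuous_fun_fst {S T : topologicalType} :
  continuous (fun z : S * T => z.1).
Proof. by move=> z; exact: cvg_fst. Qed.

Lemma continuous_fun_snd {S T : topologicalType} :
  continuous (fun z : S * T => z.2).
Proof. by move=> z; exact: cvg_snd. Qed.

Lemma continuous_fun_sqrt {R : realType} {T : topologicalType} (f : T -> R) :
  continuous f -> continuous (fun x => Num.sqrt (f x)).
Proof.
move=> cf x; exact: (continuous_comp (cf x) (@sqrt_continuous R (f x))).
Qed.

Lemma continuous_fun_inv {R : realType} {T : topologicalType} (f : T -> R) :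
  continuous f -> (forall x, f x != 0) -> continuous (fun x => (f x)^-1).
Proof. by move=> cf f0 x; apply: cvgV; [exact: f0|exact: cf]. Qed.

Lemma continuous_fun_add {R : realType} {T : topologicalType} (f g : T -> R) :
  continuous f -> continuous g -> continuous (fun x => f x + g x).
Proof. by move=> cf cg x; apply: cvgD; [exact: cf|exact: cg]. Qed.

Lemma continuous_fun_opp {R : realType} {T : topologicalType} (f : T -> R) :
  continuous f -> continuous (fun x => - f x).
Proof. by move=> cf x; apply: cvgN; exact: cf. Qed.

Lemma continuous_fun_mul {R : realType} {T : topologicalType} (f g : T -> R) :
  continuous f -> continuous g -> continuous (fun x => f x * g x).
Proof. by move=> cf cg x; apply: cvgM; [exact: cf|exact: cg]. Qed.

Lemma continuous_fun_exp {R : realType} {T : topologicalType} (f : T -> R) n :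
  continuous f -> continuous (fun x => f x ^+ n).
Proof.
move=> cf; elim: n => [|n ih]; first by move=> x; exact: cvg_cst.
by rewrite (_ : (fun x => _) = (fun x => f x * f x ^+ n));
  [exact: continuous_fun_mul|apply/funext => x; rewrite exprS].
Qed.

(** Syntax directed: choosing each rule by the head symbol avoids the costly
    failing unifications that come from trying the rules in turn. *)
Ltac continuity :=
  cbv beta;
  first
  [ assumption
  | lazymatch goal with
    | |- continuous (fun _ => ?c) => by move=> ?; apply: cvg_cst
    | |- continuous (fun x => @GRing.add _ _ _) =>
        apply: continuous_fun_add; continuity
    | |- continuous (fun x => @GRing.opp _ _) =>
        apply: continuous_fun_opp; continuity
    | |- continuous (fun x => @GRing.mul _ _ _) =>
        apply: continuous_fun_mul; continuity
    | |- continuous (fun x => @GRing.exp _ _ _) =>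
        apply: continuous_fun_exp; continuity
    | |- continuous (fun x => @GRing.inv _ _) =>
        apply: continuous_fun_inv; [continuity|]
    | |- continuous (fun x => Num.sqrt _) =>
        apply: continuous_fun_sqrt; continuity
    end
  | idtac ].

(** * Periodic square roots of loops *)

(** The loop [f1 + i f2], parametrised with period 2 pi, is the square of a
    continuous complex loop [g1 + i g2] of the same period. *)
Definition has_periodic_sqrt {R : realType} (f1 f2 : R -> R) :=
  exists g1 g2 : R -> R,
    [/\ continuous g1, continuous g2, periodic g1 (pi *+ 2),
        periodic g2 (pi *+ 2) &
        forall x, g1 x ^+ 2 - g2 x ^+ 2 = f1 x /\ 2 * (g1 x * g2 x) = f2 x].

(** The positivity hypothesis says that [q = f' * conj f] has positive real part,
    so that [q] stays away from the branch cut and has the continuous square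
    root [h = h1 + i h2] below.  If [g ^ 2 = f] then [g * h / |f|] is a square
    root of [f * f' * conj f / |f| ^ 2 = f']. *)
Lemma has_periodic_sqrt_near {R : realType} (f1 f2 f1' f2' : R -> R) :
  continuous f1 -> continuous f2 -> continuous f1' -> continuous f2' ->
  periodic f1 (pi *+ 2) -> periodic f2 (pi *+ 2) ->
  periodic f1' (pi *+ 2) -> periodic f2' (pi *+ 2) ->
  (forall x, 0 < f1' x * f1 x + f2' x * f2 x) ->
  has_periodic_sqrt f1 f2 -> has_periodic_sqrt f1' f2'.
Proof.
move=> cf1 cf2 cf1' cf2' pf1 pf2 pf1' pf2' ff'.
move=> [g1 [g2 [cg1 cg2 pg1 pg2 gf]]].
pose q1 x := f1' x * f1 x + f2' x * f2 x.
pose q2 x := f2' x * f1 x - f1' x * f2 x.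
pose m x := Num.sqrt (f1 x ^+ 2 + f2 x ^+ 2).
pose n x := Num.sqrt (q1 x ^+ 2 + q2 x ^+ 2).
pose h1 x := Num.sqrt ((n x + q1 x) / 2).
pose h2 x := q2 x * (2 * h1 x)^-1.
have q1_gt0 x : 0 < q1 x by exact: ff'.
have n2 x : n x ^+ 2 = q1 x ^+ 2 + q2 x ^+ 2.
  by rewrite sqr_sqrtr// addr_ge0// sqr_ge0.
have n_ge0 x : 0 <= n x by exact: sqrtr_ge0.
have h1_gt0 x : 0 < h1 x.
  by rewrite sqrtr_gt0 divr_gt0// ltr_wpDl.
have h12 x : h1 x ^+ 2 = (n x + q1 x) / 2.
  by rewrite sqr_sqrtr// divr_ge0// addr_ge0// ltW.
have h1h2 x : 2 * (h1 x * h2 x) = q2 x.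
  by rewrite /h2; field; rewrite gt_eqF.
have hh x : h1 x ^+ 2 - h2 x ^+ 2 = q1 x.
  have h1n0 : h1 x ^+ 2 != 0 by rewrite sqrf_eq0 gt_eqF.
  apply: (mulfI h1n0).
  have -> : h1 x ^+ 2 * (h1 x ^+ 2 - h2 x ^+ 2) =
    (h1 x ^+ 2) ^+ 2 - (2 * (h1 x * h2 x)) ^+ 2 / 4 by field.
  by rewrite h1h2 h12; have := n2 x; nra.
have m_gt0 x : 0 < m x.
  rewrite sqrtr_gt0 lt_def addr_ge0 ?sqr_ge0// andbT.
  apply/eqP => f0; have := q1_gt0 x; rewrite /q1.
  have [-> ->] : f1 x = 0 /\ f2 x = 0 by split; nra.
  by rewrite !mulr0 addr0 ltxx.
have m2 x : m x ^+ 2 = f1 x ^+ 2 + f2 x ^+ 2.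
  by rewrite sqr_sqrtr// addr_ge0// sqr_ge0.
have cq1 : continuous q1 by rewrite /q1; continuity.
have cq2 : continuous q2 by rewrite /q2; continuity.
have cm : continuous (fun x => (m x)^-1).
  apply: continuous_fun_inv; last by move=> x; rewrite gt_eqF.
  by apply: continuous_fun_sqrt; continuity.
have ch1 : continuous h1.
  apply: continuous_fun_sqrt.
  have cn : continuous n by apply: continuous_fun_sqrt; continuity.
  by continuity.
have ch2 : continuous h2.
  by rewrite /h2; continuity => x; rewrite gt_eqF// mulr_gt0.
have pq1 : periodic q1 (pi *+ 2) by move=> x; rewrite /q1 pf1 pf2 pf1' pf2'.
have pq2 : periodic q2 (pi *+ 2) by move=> x; rewrite /q2 pf1 pf2 pf1' pf2'.
have pm : periodic m (pi *+ 2) by move=> x; rewrite /m pf1 pf2.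
have ph1 : periodic h1 (pi *+ 2) by move=> x; rewrite /h1 /n pq1 pq2.
have ph2 : periodic h2 (pi *+ 2) by move=> x; rewrite /h2 ph1 pq2.
exists (fun x => (g1 x * h1 x - g2 x * h2 x) * (m x)^-1).
exists (fun x => (g1 x * h2 x + g2 x * h1 x) * (m x)^-1); split.
- by continuity.
- by continuity.
- by move=> x; rewrite pg1 pg2 ph1 ph2 pm.
- by move=> x; rewrite pg1 pg2 ph1 ph2 pm.
move=> x; have [gf1 gf2] := gf x; have m0 : m x != 0 by rewrite gt_eqF.
split.
- transitivity (((g1 x ^+ 2 - g2 x ^+ 2) * (h1 x ^+ 2 - h2 x ^+ 2) -
    2 * (g1 x * g2 x) * (2 * (h1 x * h2 x))) / m x ^+ 2); first by field.
  rewrite gf1 gf2 hh h1h2.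
  apply: (canLR (mulfK _)); first by rewrite sqrf_eq0.
  by rewrite m2 /q1 /q2; ring.
- transitivity (((g1 x ^+ 2 - g2 x ^+ 2) * (2 * (h1 x * h2 x)) +
    2 * (g1 x * g2 x) * (h1 x ^+ 2 - h2 x ^+ 2)) / m x ^+ 2); first by field.
  rewrite gf1 gf2 hh h1h2.
  apply: (canLR (mulfK _)); first by rewrite sqrf_eq0.
  by rewrite m2 /q1 /q2; ring.
Qed.

(** A root [g] gives [g (x + pi) ^ 2 = - g x ^ 2], so [g (x + pi) / g x] is one
    of [i] and [- i].  Hence the imaginary part [d x] of [g (x + pi) * conj (g x)]
    never vanishes; but [d (x + pi) = - d x] because [g] has period 2 pi, which
    the intermediate value theorem forbids. *)
Lemma circle_has_no_periodic_sqrt {R : realType} (r : R) : 0 < r ->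
  ~ has_periodic_sqrt (fun x => r * cos x) (fun x => r * sin x).
Proof.
move=> r0 [g1 [g2 [cg1 cg2 pg1 pg2 gE]]].
have cshift (g : R -> R) : continuous g -> continuous (fun x => g (x + pi)).
  move=> cg; apply: (@continuous_fun_comp _ _ _ (fun x => x + pi) g cg).
  by have := @continuous_fun_id R => ?; continuity.
have cg1' := cshift _ cg1; have cg2' := cshift _ cg2.
pose d x := g2 (x + pi) * g1 x - g1 (x + pi) * g2 x.
have cd : continuous d by rewrite /d; continuity.
have dpi x : d (x + pi) = - d x.
  by rewrite /d -addrA -mulr2n pg1 pg2; ring.
have [x _ dx] : exists2 x, x \in `[0, pi] & d x = 0.
  apply: IVT; first exact: pi_ge0.
    exact: continuous_subspaceT.
  have -> : d pi = - d 0 by rewrite -dpi add0r.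
  by case: (leP (d 0) (- d 0)) => ?; apply/andP; split; lra.
have [e1 e2] := gE x; have [] := gE (x + pi).
rewrite cosDpi sinDpi => e1' e2'.
have := cos2Dsin2 x.
move: e1 e2 e1' e2' dx; rewrite /d.
move: (g1 x) (g2 x) (g1 (x + pi)) (g2 (x + pi)) => a b a' b'.
move=> e1 e2 e1' e2' ab cs.
(* [((a' + i b') (a - i b)) ^ 2] equals [- r ^ 2], yet its base is real. *)
have : (a' * a + b' * b) ^+ 2 - (b' * a - a' * b) ^+ 2 = - r ^+ 2.
  transitivity ((a' ^+ 2 - b' ^+ 2) * (a ^+ 2 - b ^+ 2) +
     (2 * (a' * b')) * (2 * (a * b))); first by ring.
  rewrite e1 e2 e1' e2'; transitivity (- (r ^+ 2 * (cos x ^+ 2 + sin x ^+ 2))).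
    by ring.
  by rewrite cs mulr1.
rewrite ab expr0n subr0 => H.
have := sqr_ge0 (a' * a + b' * b); rewrite H.
by have := exprn_gt0 2 r0; lra.
Qed.

(** * The circle does not contract in the punctured plane *)

Lemma periodic_reduce {R : realType} (T x : R) : 0 < T ->
  exists2 y, y \in `[0, T] &
    forall f : R -> R, periodic f T -> f x = f y.
Proof.
move=> T0; exists (x - T *~ Num.floor (x / T)).
  have := floor_itv (x / T); rewrite intrD ler_pdivlMr// ltr_pdivrMr//.
  by rewrite in_itv /= -mulrzr => /andP[? ?]; apply/andP; split; lra.
move=> f pf; case: (Num.floor _) => n.
  by rewrite -{1}(subrK (T *+ n) x) -pmulrn periodicn.
by rewrite NegzE mulrNz opprK -pmulrn periodicn.
Qed.

(** The connectedness of the line, for predicates. *)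
Lemma locally_constant_prop {R : realType} (P : R -> Prop) (a b : R) :
  (forall t, \forall s \near t, P s <-> P t) -> P a -> P b.
Proof.
move=> Ploc Pa.
have conn : connected [set: R] by apply/connected_intervalP.
suff -> : P = [set: R] by [].
apply: conn; first by exists a.
  exists P; last by rewrite setTI.
  by rewrite openE => t Pt; have := Ploc t; apply: filterS => s [_]; exact.
exists P; last by rewrite setTI.
rewrite -openC openE => t nPt; have := Ploc t.
by apply: filterS => s [Pst _] Ps; exact: nPt (Pst Ps).
Qed.

(** [F] is a homotopy of loops avoiding the origin, from the circle of radius
    [r] to a constant.  Having a periodic square root is a locally constant property
    of the time: the compactness of one period gives, around each time [t], a
    neighbourhood on which all the loops are close to the loop at [t]
    simultaneously at all points. *)
Lemma circle_not_null_homotopic {R : realType} (r : R) (F1 F2 : R * R -> R) :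
  0 < r -> continuous F1 -> continuous F2 ->
  (forall t, periodic (fun x => F1 (x, t)) (pi *+ 2)) ->
  (forall t, periodic (fun x => F2 (x, t)) (pi *+ 2)) ->
  (forall z, 0 < F1 z ^+ 2 + F2 z ^+ 2) ->
  (forall x, F1 (x, 0) = r * cos x) -> (forall x, F2 (x, 0) = r * sin x) ->
  (forall x, F1 (x, 1) = r) -> (forall x, F2 (x, 1) = 0) ->
  False.
Proof.
move=> r0 cF1 cF2 pF1 pF2 F0 F10 F20 F11 F21.
pose P t := has_periodic_sqrt (fun x => F1 (x, t)) (fun x => F2 (x, t)).
have slice (G : R * R -> R) t : continuous G -> continuous (fun x => G (x, t)).
  move=> cG; apply: (@continuous_fun_comp _ _ _ (fun x => (x, t)) G cG).
  exact: (continuous_fun_pair _ _ continuous_fun_id (continuous_fun_cst t)).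
apply: (@circle_has_no_periodic_sqrt R r r0).
suff : P 0.
  by rewrite /P; under eq_fun do rewrite F10;
     under [X in has_periodic_sqrt _ X]eq_fun do rewrite F20.
apply: (@locally_constant_prop R P 1); last first.
  exists (fun=> Num.sqrt r), (fun=> 0); split => //.
  - by move=> ?; exact: cvg_cst.
  - by move=> ?; exact: cvg_cst.
  - by move=> x; rewrite F11 F21 sqr_sqrtr ?ltW// expr0n subr0 !mulr0.
move=> t.
(* The real part of [F (x, s) * conj (F (x, t))], to be kept positive. *)
pose Q (z : R * R) := F1 z * F1 (z.1, t) + F2 z * F2 (z.1, t).
have frozen (G : R * R -> R) :
    continuous G -> continuous (fun z : R * R => G (z.1, t)).
  move=> cG.
  apply: (@continuous_fun_comp _ _ _ (fun z : R * R => (z.1, t)) G cG).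
  exact: (continuous_fun_pair _ _ continuous_fun_fst (continuous_fun_cst t)).
have cQ : continuous Q.
  by have := frozen _ cF1; have := frozen _ cF2 => ? ?; rewrite /Q; continuity.
have : \forall s \near t, `[0, pi *+ 2] `<=` [set x | 0 < Q (x, s)].
  have /compact_near_coveringP := @segment_compact R 0 (pi *+ 2).
  move=> /(_ R (nbhs t) (fun s x => 0 < Q (x, s)) _); apply => x _.
  have : \forall z \near (x, t), 0 < Q z.
    by apply: (cvgr_gt _ (cQ (x, t))); rewrite /Q /= -!expr2.
  by apply: filterS => -[].
apply: filterS => s Qs.
have twopi_gt0 : 0 < (pi : R) *+ 2 by rewrite pmulrn_lgt0// pi_gt0.
have Qpos x : 0 < Q (x, s).
  have [y yI yE] := @periodic_reduce R (pi *+ 2) x twopi_gt0.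
  rewrite (yE (fun x => Q (x, s))); first exact: Qs.
  by move=> u; rewrite /Q /= pF1 pF2 pF1 pF2.
split; apply: has_periodic_sqrt_near;
  try exact: slice; try exact: pF1; try exact: pF2.
- by move=> x; have := Qpos x; rewrite /Q /= mulrC [X in _ + X]mulrC.
- by move=> x; have := Qpos x.
Qed.

(** * Coordinates on the free space *)

Definition cartesian {R : realType} {lR lO : R} (j : 'I_2)
    (p : free_space lR lO) : R :=
  (set_val p : 'rV[R]_2) ord0 j.

Definition modulus {R : realType} {lR lO : R} (p : free_space lR lO) : R :=
  euclidean_norm (set_val p : 'rV[R]_2).

Section FreeSpace.
Context {R : realType} {lR lO : R}.
Local Notation X := (free_space lR lO).
Local Notation x_ := (@cartesian R lR lO ord0).
Local Notation y_ := (@cartesian R lR lO ord_max).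

Lemma euclidean_norm2E (v : 'rV[R]_2) :
  euclidean_norm v = Num.sqrt (v ord0 ord0 ^+ 2 + v ord0 ord_max ^+ 2).
Proof.
rewrite /euclidean_norm !big_ord_recl big_ord0 addr0.
by rewrite (_ : lift ord0 ord0 = ord_max) //; exact: val_inj.
Qed.

Lemma modulusE (p : X) : modulus p = Num.sqrt (x_ p ^+ 2 + y_ p ^+ 2).
Proof. exact: euclidean_norm2E. Qed.

Lemma sqr_modulus (p : X) : modulus p ^+ 2 = x_ p ^+ 2 + y_ p ^+ 2.
Proof. by rewrite modulusE sqr_sqrtr// addr_ge0// sqr_ge0. Qed.

Lemma modulus_gt (p : X) : lO + lR < modulus p.
Proof. by case: p => v vP; move/set_mem : (vP). Qed.

Lemma free_space_eq (p q : X) : x_ p = x_ q -> y_ p = y_ q -> p = q.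
Proof.
move=> xpq ypq; apply: val_inj; apply/rowP => j.
have [-> //|->//] : j = ord0 \/ j = ord_max.
by case: j => -[|[|//]] ?; [left|right]; exact: val_inj.
Qed.

Lemma continuous_cartesian j : continuous (@cartesian R lR lO j).
Proof.
apply: (@continuous_fun_comp _ _ _ (set_val : X -> 'rV[R]_2)
  (fun v => v ord0 j)).
  exact: coord_continuous.
exact: initial_continuous.
Qed.

Lemma continuous_modulus : continuous (@modulus R lR lO).
Proof.
rewrite (_ : modulus = fun p => Num.sqrt (x_ p ^+ 2 + y_ p ^+ 2)).
  have := continuous_cartesian ord0.
  have := continuous_cartesian ord_max => ? ?.
  by continuity.
by apply/funext => p; exact: modulusE.
Qed.

Lemma continuous_to_free_space {T : topologicalType} (f : T -> X) :
  continuous (fun t => x_ (f t)) -> continuous (fun t => y_ (f t)) ->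
  continuous f.
Proof.
move=> cx cy; apply: continuous_comp_initial => t A [P fP PA].
have Px : \forall s \near t, P ord0 ord0 (x_ (f s)) := cx t _ (fP ord0 ord0).
have Py : \forall s \near t, P ord0 ord_max (y_ (f s)) :=
  cy t _ (fP ord0 ord_max).
suff : \forall s \near t, A (set_val (f s)) by [].
near=> s; apply: PA => i j; rewrite ord1.
have [->|->] : j = ord0 \/ j = ord_max.
- by case: j => -[|[|//]] ?; [left|right]; exact: val_inj.
- by near: s.
- by near: s.
Unshelve. all: by end_near. Qed.

Lemma point_subproof (a b : R) : lO + lR < Num.sqrt (a ^+ 2 + b ^+ 2) ->
  (\row_(j < 2) if j == ord0 then a else b) \in
    [set p : 'rV[R]_2 | lO + lR < euclidean_norm p].
Proof. by move=> ab; apply: mem_set; rewrite /= euclidean_norm2E !mxE. Qed.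

Definition free_point (a b : R)
    (ab : lO + lR < Num.sqrt (a ^+ 2 + b ^+ 2)) : X :=
  exist (fun v => v \in [set p : 'rV[R]_2 | lO + lR < euclidean_norm p]) _
    (point_subproof a b ab).

Lemma cartesian_point0 a b ab : x_ (free_point a b ab) = a.
Proof. by rewrite /cartesian /= mxE. Qed.

Lemma cartesian_point1 a b ab : y_ (free_point a b ab) = b.
Proof. by rewrite /cartesian /= mxE. Qed.

End FreeSpace.

(** * Paths and homotopies *)

Lemma clamp_subproof {R : realType} (t : R) :
  Num.max 0 (Num.min 1 t) \in [set t : R | 0 <= t <= 1].
Proof.
by apply: mem_set => /=; rewrite le_max lexx ge_max ler01 ge_min lexx.
Qed.

(** The retraction of the line onto the unit interval.  Extending paths and
    homotopies along it makes time range over the line, where local compactness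
    and connectedness are at hand. *)
Definition clamp {R : realType} (t : R) : unit_interval R :=
  exist (fun r => r \in [set t : R | 0 <= t <= 1]) _ (clamp_subproof t).

Lemma continuous_clamp {R : realType} : continuous (@clamp R).
Proof.
apply: continuous_comp_initial.
have cmin : continuous (fun t : R => Num.min 1 t).
  by apply: min_fun_continuous;
    [exact: continuous_fun_cst|exact: continuous_fun_id].
by apply: max_fun_continuous; [exact: continuous_fun_cst|exact: cmin].
Qed.

Lemma clamp0 {R : realType} : clamp 0 = unit_interval0 R.
Proof. by apply: val_inj; rewrite /= min_r// max_l. Qed.

Lemma clamp1 {R : realType} : clamp 1 = unit_interval1 R.
Proof. by apply: val_inj; rewrite /= min_l// max_r. Qed.

(** Precomposition with [clamp] is continuous for the compact-open topologies,
    since [clamp] maps compact sets to compact sets; uncurrying over the locally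
    compact line then gives joint continuity. *)
Lemma continuous_path_eval_clamp {R : realType} {T X : topologicalType}
    (s : T -> path_space R X) : continuous s ->
  continuous (fun z : T * R => path_eval (s z.1) (clamp z.2)).
Proof.
move=> cs.
pose f (t : T) : {compact-open, R -> X} :=
  fun r : R => path_eval (s t) (clamp r).
have cf : continuous f.
  move=> t; apply/compact_open_cvgP => K O cK oO fKO.
  have ct : {for t, continuous
      (fun t => (s t : continuousType _ _) :
         {compact-open, unit_interval R -> X})}.
    have := continuous_comp (cs t) (@initial_continuous _ _ _ (s t)).
    exact.
  have cK' : compact (clamp @` K).
    apply: continuous_compact => //; apply: continuous_subspaceT.
    exact: continuous_clamp.
  move/compact_open_cvgP : ct => /(_ _ _ cK' oO) H.
  have : \forall t' \near t,
      [set path_eval (s t') i | i in clamp @` K] `<=` O.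
    apply: H => x [_ [r Kr <-] <-]; apply: fKO; by exists r.
  apply: filterS => t' st'O x [r Kr <-]; apply: st'O.
  by exists (clamp r) => //; exists r.
have cfr t : continuous (f t).
  apply: continuous_fun_comp; last exact: continuous_clamp.
  exact: (@cts_fun _ _ (s t : continuousType _ _)).
have := @continuous_uncurry T R X f
  (@locally_compactR R) (@Rhausdorff R) cf cfr.
rewrite (_ : uncurry f = fun z => f z.1 z.2) //.
by apply/funext => -[].
Qed.

Lemma path_space_of_homotopy {R : realType} {T X : topologicalType}
    (f : T * unit_interval R -> X) : continuous f ->
  exists2 s : T -> path_space R X, continuous s &
    forall t i, path_eval (s t) i = f (t, i).
Proof.
move=> /continuous_curry [cf cft].
exists (fun t => (mkcts (cft t) : continuousType _ _)) => //.
exact: continuous_comp_initial.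
Qed.

(** * Two planners *)

(** With [p = (x1, y1)] of norm [a] and [q = (x2, y2)] of norm [b], the vectors
    [b p] and [a q] have the same norm, so the segment between them can only
    meet the origin at its midpoint, when they are opposite. *)
Lemma segment_avoids_origin {R : realType} (a b x1 y1 x2 y2 t : R) :
  0 < a -> 0 < b -> a ^+ 2 = x1 ^+ 2 + y1 ^+ 2 -> b ^+ 2 = x2 ^+ 2 + y2 ^+ 2 ->
  0 < a * b + (x1 * x2 + y1 * y2) -> 0 <= t -> t <= 1 ->
  0 < ((1 - t) * (b * x1) + t * (a * x2)) ^+ 2 +
      ((1 - t) * (b * y1) + t * (a * y2)) ^+ 2.
Proof.
move=> a0 b0 a2 b2 ab t0 t1; have N0 : 0 < a * b by rewrite mulr_gt0.
rewrite (_ : _ + _ = (a * b) * ((1 - 2 * t) ^+ 2 * (a * b) +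
  2 * (t * (1 - t)) * (a * b + (x1 * x2 + y1 * y2)))); last first.
  transitivity (b ^+ 2 * (1 - t) ^+ 2 * (x1 ^+ 2 + y1 ^+ 2) +
    a ^+ 2 * t ^+ 2 * (x2 ^+ 2 + y2 ^+ 2) +
    2 * (t * (1 - t)) * (a * b) * (x1 * x2 + y1 * y2)); first by ring.
  by rewrite -a2 -b2; ring.
apply: mulr_gt0 => //.
have [t_eq0|t_neq0] := eqVneq t 0; first by rewrite t_eq0; lra.
have [t_eq1|t_neq1] := eqVneq t 1; first by rewrite t_eq1; lra.
apply: ltr_wpDl; first by rewrite mulr_ge0 ?sqr_ge0// ltW.
by rewrite !mulr_gt0// ?subr_gt0 lt_neqAle ?t_neq1 1?eq_sym ?t_neq0.
Qed.

(** The segment from [a] to [b], two vectors of norm [N], is scaled by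
    [d = |a - b|] and bumped along [a - b] turned by a quarter of a turn.
    The component along [a - b] vanishes only at the midpoint.  There the bump
    has length [2 N d], because of the factor 8, and cannot cancel the midpoint
    of the segment, whose length is at most [N d]. *)
Lemma detour_avoids_origin {R : realType} (N d a1 a2 b1 b2 t : R) :
  0 < N -> 0 < d -> d ^+ 2 = (a1 - b1) ^+ 2 + (a2 - b2) ^+ 2 ->
  a1 ^+ 2 + a2 ^+ 2 = N ^+ 2 -> b1 ^+ 2 + b2 ^+ 2 = N ^+ 2 ->
  0 < (d * ((1 - t) * a1 + t * b1) - 8 * N * (t * (1 - t)) * (a2 - b2)) ^+ 2 +
      (d * ((1 - t) * a2 + t * b2) + 8 * N * (t * (1 - t)) * (a1 - b1)) ^+ 2.
Proof.
move=> N0 d0 dE aE bE.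
set q1 := _ - _ * (a2 - b2); set q2 := _ + _ * (a1 - b1).
rewrite lt_neqAle addr_ge0 ?sqr_ge0// andbT eq_sym paddr_eq0 ?sqr_ge0//.
rewrite !sqrf_eq0; apply/negP => /andP[/eqP q1E /eqP q2E].
(* Twice the inner product of the curve with [a - b], in closed form. *)
have d3 : d ^+ 3 * (1 - 2 * t) = 0.
  transitivity (2 * (q1 * (a1 - b1) + q2 * (a2 - b2)) -
     d * (1 - 2 * t) * ((a1 - b1) ^+ 2 + (a2 - b2) ^+ 2 - d ^+ 2) -
     d * (a1 ^+ 2 + a2 ^+ 2 - (b1 ^+ 2 + b2 ^+ 2))).
    by rewrite /q1 /q2; ring.
  by rewrite q1E q2E aE bE -dE; ring.
have t_half : t = 1 / 2.
  move/eqP: d3; rewrite mulf_eq0 expf_eq0 /= gt_eqF//= => /eqP ?; lra.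
have e1 : d * (a1 + b1) = 4 * N * (a2 - b2).
  by apply: subr0_eq; move: q1E; rewrite /q1 t_half; lra.
have e2 : d * (a2 + b2) = - (4 * N * (a1 - b1)).
  by apply: subr0_eq; move: q2E; rewrite /q2 t_half; lra.
(* Square and add [e1] and [e2], and use [|a + b| ^ 2 = 4 N ^ 2 - d ^ 2]. *)
have : d ^+ 2 * (12 * N ^+ 2 + d ^+ 2) = 0.
  transitivity (16 * N ^+ 2 * ((a1 - b1) ^+ 2 + (a2 - b2) ^+ 2) -
    d ^+ 2 * (2 * (N ^+ 2 + N ^+ 2) - ((a1 - b1) ^+ 2 + (a2 - b2) ^+ 2))).
    by rewrite -dE; ring.
  rewrite -{2}aE -{2}bE.
  transitivity ((4 * N * (a2 - b2)) ^+ 2 + (- (4 * N * (a1 - b1))) ^+ 2 -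
    ((d * (a1 + b1)) ^+ 2 + (d * (a2 + b2)) ^+ 2)); first by ring.
  by rewrite e1 e2 subrr.
apply/eqP; rewrite gt_eqF// mulr_gt0 ?exprn_gt0// addr_gt0 ?exprn_gt0//.
by rewrite mulr_gt0 ?exprn_gt0.
Qed.

Lemma unit_interval0E {R : realType} : set_val (unit_interval0 R) = 0 :> R.
Proof. by []. Qed.

Lemma unit_interval1E {R : realType} : set_val (unit_interval1 R) = 1 :> R.
Proof. by []. Qed.

Section Planners.
Context {R : realType} (lR lO : R) (hR : 0 < lR) (hO : 0 < lO).
Local Notation X := (free_space lR lO).
Local Notation x_ := (@cartesian R lR lO ord0).
Local Notation y_ := (@cartesian R lR lO ord_max).
Local Notation I := (unit_interval R).

Lemma modulus_gt0 (p : X) : 0 < modulus p.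
Proof. by apply: lt_trans (modulus_gt p); exact: addr_gt0. Qed.

(** Two points on the same ray from the origin at the same distance. *)
Lemma same_ray_eq (p q : X) (c : R) : 0 < c -> modulus p = modulus q ->
  x_ p = c * x_ q -> y_ p = c * y_ q -> p = q.
Proof.
move=> c0 r xE yE; have c1 : c = 1.
  have : (c ^+ 2 - 1) * modulus q ^+ 2 = 0.
    by rewrite mulrBl mul1r -{2}r !sqr_modulus xE yE; ring.
  move/eqP; rewrite mulf_eq0 sqrf_eq0 (gt_eqF (modulus_gt0 q)) orbF => /eqP ?.
  by nra.
by apply: free_space_eq; rewrite ?xE ?yE c1 mul1r.
Qed.

Lemma continuous_endpoint_data :
  [/\ continuous (fun z : X * X => modulus z.1),
      continuous (fun z : X * X => modulus z.2) &
      (forall j, continuous (fun z : X * X => cartesian j z.1) /\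
                 continuous (fun z : X * X => cartesian j z.2))].
Proof.
have c1 := @continuous_fun_fst X X; have c2 := @continuous_fun_snd X X.
split; last move=> j; try split.
- exact: (continuous_fun_comp _ _ continuous_modulus c1).
- exact: (continuous_fun_comp _ _ continuous_modulus c2).
- exact: (continuous_fun_comp _ _ (continuous_cartesian j) c1).
- exact: (continuous_fun_comp _ _ (continuous_cartesian j) c2).
Qed.

Lemma continuous_restrict {T : topologicalType} (U : set (X * X))
    (f : X * X -> T) :
  continuous f -> continuous (fun z : U * I => f (set_val z.1)).
Proof.
move=> cf; apply: (@continuous_fun_comp _ _ _ (fun z : U * I => set_val z.1)).
  exact: cf.
apply: (@continuous_fun_comp _ _ _ (fun z : U * I => z.1)).
  exact: initial_continuous.
exact: continuous_fun_fst.
Qed.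

Lemma continuous_time (U : set (X * X)) :
  continuous (fun z : U * I => set_val z.2 : R).
Proof.
apply: (@continuous_fun_comp _ _ _ (fun z : U * I => z.2)).
  exact: initial_continuous.
exact: continuous_fun_snd.
Qed.

(** The direction field [(q1, q2)] determines the planner: the position is the
    normalised direction times the interpolated modulus [rho], which remains
    above the radius of the excluded disc because it is a convex combination of
    two values above it. *)
Lemma motion_planner_of_direction (U : set (X * X)) (q1 q2 : U * I -> R) :
  continuous q1 -> continuous q2 ->
  (forall z, 0 < q1 z ^+ 2 + q2 z ^+ 2) ->
  (forall u : U, exists2 c, 0 < c &
     q1 (u, unit_interval0 R) = c * x_ (set_val u).1 /\
     q2 (u, unit_interval0 R) = c * y_ (set_val u).1) ->
  (forall u : U, exists2 c, 0 < c &
     q1 (u, unit_interval1 R) = c * x_ (set_val u).2 /\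
     q2 (u, unit_interval1 R) = c * y_ (set_val u).2) ->
  has_motion_planner R U.
Proof.
move=> cq1 cq2 q0 qsrc qtgt.
pose n z := Num.sqrt (q1 z ^+ 2 + q2 z ^+ 2).
have n0 z : 0 < n z by rewrite sqrtr_gt0.
have n2 z : n z ^+ 2 = q1 z ^+ 2 + q2 z ^+ 2 by rewrite sqr_sqrtr// ltW.
pose rho (z : U * I) : R := (1 - set_val z.2) * modulus (set_val z.1).1 +
   set_val z.2 * modulus (set_val z.1).2.
have rho_gt z : lO + lR < rho z.
  have /andP[t0 t1] : 0 <= (set_val z.2 : R) <= 1 by have /set_mem := valP z.2.
  have := modulus_gt (set_val z.1).1; have := modulus_gt (set_val z.1).2.
  rewrite /rho.
  move: (set_val z.2) (modulus _) (modulus _) t0 t1 => t a b t0 t1.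
  by move=> la lb; have [ab|/ltW ba] := leP a b; nra.
have rho_gt0 z : 0 < rho z by apply: lt_trans (rho_gt z); exact: addr_gt0.
have npos z :
    Num.sqrt ((rho z * q1 z / n z) ^+ 2 + (rho z * q2 z / n z) ^+ 2) = rho z.
  rewrite (_ : _ + _ = rho z ^+ 2) ?sqrtr_sqr ?ger0_norm ?ltW//.
  rewrite !exprMn !exprVn -mulrDl -mulrDr -n2 mulfK//.
  by rewrite sqrf_eq0 gt_eqF.
have nP z : lO + lR <
    Num.sqrt ((rho z * q1 z / n z) ^+ 2 + (rho z * q2 z / n z) ^+ 2).
  by rewrite npos.
pose f z : X := free_point _ _ (nP z).
have ct := continuous_time U.
have crho : continuous rho.
  have [c1 c2 _] := continuous_endpoint_data.
  have := continuous_restrict U _ c1; have := continuous_restrict U _ c2 => ? ?.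
  by rewrite /rho; continuity.
have cn : continuous n by rewrite /n; continuity.
have cf : continuous f.
  apply: continuous_to_free_space.
  - rewrite (_ : (fun z => x_ (f z)) = fun z => rho z * q1 z / n z).
      by continuity => z; rewrite gt_eqF.
    by apply/funext => z; exact: cartesian_point0.
  - rewrite (_ : (fun z => y_ (f z)) = fun z => rho z * q2 z / n z).
      by continuity => z; rewrite gt_eqF.
    by apply/funext => z; exact: cartesian_point1.
have [s cs sE] := path_space_of_homotopy _ cf.
exists s; split => // u; rewrite !sE; split.
- have [c c0 [e1 e2]] := qsrc u.
  have r0 : rho (u, unit_interval0 R) = modulus (set_val u).1.
    by rewrite /rho /= subr0 mul1r mul0r addr0.
  apply: (@same_ray_eq _ _
    (rho (u, unit_interval0 R) * c / n (u, unit_interval0 R))).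
  + by rewrite divr_gt0// mulr_gt0.
  + by rewrite modulusE cartesian_point0 cartesian_point1 npos.
  + by rewrite cartesian_point0 e1; ring.
  + by rewrite cartesian_point1 e2; ring.
- have [c c0 [e1 e2]] := qtgt u.
  have r1 : rho (u, unit_interval1 R) = modulus (set_val u).2.
    by rewrite /rho /= subrr mul0r mul1r add0r.
  apply: (@same_ray_eq _ _
    (rho (u, unit_interval1 R) * c / n (u, unit_interval1 R))).
  + by rewrite divr_gt0// mulr_gt0.
  + by rewrite modulusE cartesian_point0 cartesian_point1 npos.
  + by rewrite cartesian_point0 e1; ring.
  + by rewrite cartesian_point1 e2; ring.
Qed.

Definition dot (z : X * X) : R := x_ z.1 * x_ z.2 + y_ z.1 * y_ z.2.

(** By the Cauchy-Schwarz inequality, this excludes exactly the pairs on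
    opposite rays, as [not_aligned] does for the pairs on the same ray. *)
Definition not_opposite : set (X * X) :=
  [set z | 0 < modulus z.1 * modulus z.2 + dot z].

Definition not_aligned : set (X * X) :=
  [set z | 0 < modulus z.1 * modulus z.2 - dot z].

Lemma open_positive {T : topologicalType} (f : T -> R) :
  continuous f -> open [set z | 0 < f z].
Proof. by move=> /continuousP /(_ _ (@open_gt R 0)). Qed.

Lemma open_not_opposite : open not_opposite.
Proof.
have [c1 c2 cc] := continuous_endpoint_data.
have [c3 c4] := cc ord0; have [c5 c6] := cc ord_max.
by apply: open_positive; rewrite /dot; continuity.
Qed.

Lemma open_not_aligned : open not_aligned.
Proof.
have [c1 c2 cc] := continuous_endpoint_data.
have [c3 c4] := cc ord0; have [c5 c6] := cc ord_max.
by apply: open_positive; rewrite /dot; continuity.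
Qed.

Lemma not_opposite_or_not_aligned (z : X * X) : not_opposite z \/ not_aligned z.
Proof.
rewrite /not_opposite /not_aligned /=.
have : 0 < modulus z.1 * modulus z.2 by rewrite mulr_gt0// modulus_gt0.
by case: (ltP 0 (dot z)) => ? ?; [left|right]; lra.
Qed.

Lemma planner_not_opposite : has_motion_planner R not_opposite.
Proof.
have [c1 c2 cc] := continuous_endpoint_data.
have [c3 c4] := cc ord0; have [c5 c6] := cc ord_max.
have ct := continuous_time not_opposite.
have := continuous_restrict not_opposite _ c1.
have := continuous_restrict not_opposite _ c2.
have := continuous_restrict not_opposite _ c3.
have := continuous_restrict not_opposite _ c4.
have := continuous_restrict not_opposite _ c5.
have := continuous_restrict not_opposite _ c6 => ? ? ? ? ? ?.
pose q j (z : not_opposite * I) : R :=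
  (1 - set_val z.2) * (modulus (set_val z.1).2 * cartesian j (set_val z.1).1) +
  set_val z.2 * (modulus (set_val z.1).1 * cartesian j (set_val z.1).2).
apply: (motion_planner_of_direction _ (q ord0) (q ord_max)).
- by rewrite /q; continuity.
- by rewrite /q; continuity.
- move=> z; have : not_opposite (set_val z.1) by apply/set_mem/valP.
  have /andP[t0 t1] : 0 <= (set_val z.2 : R) <= 1 by have /set_mem := valP z.2.
  by move=> nopp; apply: segment_avoids_origin => //;
    first [exact: modulus_gt0|exact: sqr_modulus].
- move=> u; exists (modulus (set_val u).2); first exact: modulus_gt0.
  by rewrite /q /= subr0 !mul1r !mul0r !addr0.
- move=> u; exists (modulus (set_val u).1); first exact: modulus_gt0.
  by rewrite /q /= subrr !mul1r !mul0r !add0r.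
Qed.

Lemma planner_not_aligned : has_motion_planner R not_aligned.
Proof.
have [c1 c2 cc] := continuous_endpoint_data.
have [c3 c4] := cc ord0; have [c5 c6] := cc ord_max.
have ct := continuous_time not_aligned.
have := continuous_restrict not_aligned _ c1.
have := continuous_restrict not_aligned _ c2.
have := continuous_restrict not_aligned _ c3.
have := continuous_restrict not_aligned _ c4.
have := continuous_restrict not_aligned _ c5.
have := continuous_restrict not_aligned _ c6 => ? ? ? ? ? ?.
(* The source and the target, both scaled to the product of their moduli. *)
pose N (z : not_aligned * I) :=
  modulus (set_val z.1).1 * modulus (set_val z.1).2.
pose A j (z : not_aligned * I) :=
  modulus (set_val z.1).2 * cartesian j (set_val z.1).1.
pose B j (z : not_aligned * I) :=
  modulus (set_val z.1).1 * cartesian j (set_val z.1).2.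
pose D z := Num.sqrt
  ((A ord0 z - B ord0 z) ^+ 2 + (A ord_max z - B ord_max z) ^+ 2).
pose k z : R := 8 * N z * (set_val z.2 * (1 - set_val z.2)).
pose q1 z := D z * ((1 - set_val z.2) * A ord0 z + set_val z.2 * B ord0 z) -
  k z * (A ord_max z - B ord_max z).
pose q2 z := D z *
  ((1 - set_val z.2) * A ord_max z + set_val z.2 * B ord_max z) +
  k z * (A ord0 z - B ord0 z).
have D2 z :
    D z ^+ 2 = (A ord0 z - B ord0 z) ^+ 2 + (A ord_max z - B ord_max z) ^+ 2.
  by rewrite sqr_sqrtr// addr_ge0// sqr_ge0.
have AE z : A ord0 z ^+ 2 + A ord_max z ^+ 2 = N z ^+ 2.
  by rewrite /N /A !exprMn -mulrDr -sqr_modulus mulrC.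
have BE z : B ord0 z ^+ 2 + B ord_max z ^+ 2 = N z ^+ 2.
  by rewrite /N /B !exprMn -mulrDr -sqr_modulus.
have N_gt0 z : 0 < N z by rewrite mulr_gt0// modulus_gt0.
have D_gt0 z : 0 < D z.
  have : not_aligned (set_val z.1) by apply/set_mem/valP.
  rewrite /not_aligned /= -/(N z) => nal; rewrite sqrtr_gt0.
  have -> : (A ord0 z - B ord0 z) ^+ 2 + (A ord_max z - B ord_max z) ^+ 2 =
      2 * N z * (N z - dot (set_val z.1)).
    transitivity (A ord0 z ^+ 2 + A ord_max z ^+ 2 +
      (B ord0 z ^+ 2 + B ord_max z ^+ 2) -
      2 * (A ord0 z * B ord0 z + A ord_max z * B ord_max z)); first by ring.
    by rewrite AE BE /A /B /N /dot; ring.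
  by rewrite mulr_gt0// mulr_gt0.
have cD : continuous D by rewrite /D /A /B; continuity.
have ck : continuous k by rewrite /k /N; continuity.
apply: (motion_planner_of_direction _ q1 q2).
- by rewrite /q1 /A /B; continuity.
- by rewrite /q2 /A /B; continuity.
- move=> z.
  exact: (detour_avoids_origin _ _ _ _ _ _ _
    (N_gt0 z) (D_gt0 z) (D2 z) (AE z) (BE z)).
- move=> u; exists (D (u, unit_interval0 R) * modulus (set_val u).2).
    by rewrite mulr_gt0// modulus_gt0.
  by rewrite /q1 /q2 /k /A /= unit_interval0E subr0; split; ring.
- move=> u; exists (D (u, unit_interval1 R) * modulus (set_val u).1).
    by rewrite mulr_gt0// modulus_gt0.
  by rewrite /q1 /q2 /k /B /= unit_interval1E subrr; split; ring.
Qed.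

(** * One planner is not enough *)

(** Planning from each point of a circle around the obstacle to a fixed point of
    that circle contracts the circle to this point. *)
Lemma no_global_planner : ~ has_motion_planner R ([set: X * X]).
Proof.
move=> [s [cs sE]].
pose r : R := 2 * (lO + lR).
have r0 : 0 < r by rewrite mulr_gt0// addr_gt0.
have circleP a : lO + lR < Num.sqrt ((r * cos a) ^+ 2 + (r * sin a) ^+ 2).
  rewrite (exprMn 2 r) (exprMn 2 r) -mulrDr cos2Dsin2 mulr1 sqrtr_sqr.
  rewrite ger0_norm ?(ltW r0)// /r.
  by have := addr_gt0 hO hR; lra.
pose circle a : X := free_point _ _ (circleP a).
have ccircle : continuous circle.
  apply: continuous_to_free_space.
  - rewrite (_ : (fun z => x_ (circle z)) = fun a => r * cos a).
      by have := @continuous_cos R => ?; continuity.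
    by apply/funext => a; exact: cartesian_point0.
  - rewrite (_ : (fun z => y_ (circle z)) = fun a => r * sin a).
      by have := @continuous_sin R => ?; continuity.
    by apply/funext => a; exact: cartesian_point1.
have circle_periodic : forall a, circle (a + pi *+ 2) = circle a.
  by move=> a; apply: free_space_eq;
    rewrite ?cartesian_point0 ?cartesian_point1 ?cosD2pi ?sinD2pi.
pose pr a : [set: X * X] := exist (fun z => z \in [set: X * X])
  (circle a, circle 0) (in_setT _).
have cpr : continuous pr.
  apply: continuous_comp_initial.
  exact: (continuous_fun_pair _ _ ccircle (continuous_fun_cst (circle 0))).
pose s' a := s (pr a).
have cs' : continuous s' by exact: (continuous_fun_comp _ _ cs cpr).
have cH := continuous_path_eval_clamp s' cs'.
pose H (z : R * R) : X := path_eval (s' z.1) (clamp z.2).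
apply: (@circle_not_null_homotopic R r
  (fun z => x_ (H z)) (fun z => y_ (H z))) => //.
- exact: (continuous_fun_comp _ _ (continuous_cartesian ord0) cH).
- exact: (continuous_fun_comp _ _ (continuous_cartesian ord_max) cH).
- by move=> t a; rewrite /H /s' /pr /= circle_periodic.
- by move=> t a; rewrite /H /s' /pr /= circle_periodic.
- by move=> z; rewrite -sqr_modulus exprn_gt0// modulus_gt0.
- by move=> a; rewrite /H /= clamp0 (sE (pr a)).1 /= cartesian_point0.
- by move=> a; rewrite /H /= clamp0 (sE (pr a)).1 /= cartesian_point1.
- move=> a; rewrite /H /= clamp1 (sE (pr a)).2 /= cartesian_point0.
  by rewrite cos0 mulr1.
- move=> a; rewrite /H /= clamp1 (sE (pr a)).2 /= cartesian_point1.
  by rewrite sin0 mulr0.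
Qed.

Lemma motion_cover_free_space2 : motion_cover R X 2.
Proof.
exists (fun i => if i == ord0 then not_opposite else not_aligned); split.
- move=> i; case: eqP => _; first exact: open_not_opposite.
  exact: open_not_aligned.
- apply/seteqP; split => // z _.
  by have [?|?] := not_opposite_or_not_aligned z; [exists ord0|exists ord_max].
- move=> i; case: eqP => _; first exact: planner_not_opposite.
  exact: planner_not_aligned.
Qed.

Lemma not_motion_cover_free_space1 : ~ motion_cover R X 1.
Proof.
move=> [U [_ covU plU]]; apply: no_global_planner.
rewrite -covU (_ : \bigcup_i U i = U ord0); first exact: plU.
apply/seteqP; split => [z [i _]|z Uz]; first by rewrite ord1.
by exists ord0.
Qed.

End Planners.

Theorem mainTheorem1 (R : realType) (lR lO : R) (hR : 0 < lR) (hO : 0 < lO) :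
  TC R (free_space lR lO) = Some 2%N.
Proof.
rewrite /TC; case: pselect => [exm|[]]; last first.
  by exists 2%N; apply/asboolP; exact: motion_cover_free_space2.
congr Some; case: ex_minnP => -[|[|[|m]]] //.
- by move=> /andP[_ /asboolP /(not_motion_cover_free_space1 _ _ hR hO)].
- move=> _ /(_ 2%N); apply: contraPP => _ H.
  suff : (m.+3 <= 2)%N by [].
  by apply: H; apply/asboolP; exact: motion_cover_free_space2.
Qed.
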